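(* For any $n_0\in\{\underline n,\ldots,\overline n\}$, an optimal dynamic quotation strategy for the problem $$Z(n_0)=\sup_{D_{n_0}}S(n_0,D_{n_0}),$$ subject to the condition that the balking threshold equals $n_0$, is $$D^S_{n_0}=(\tilde d^S_0,\ldots,\tilde d^S_{n_0-1},\tilde d^P_{n_0}+\epsilon)$$ for any $\epsilon>0$.
   Context: Parameters: $\lambda,\mu>0$ (arrival and service rates of an observable M/M/1 system), $\rho=\lambda/\mu$; service value $R$, entrance fee $p$, waiting cost rate $c>0$, compensation rate $l$, risk-aversion coefficient $r>0$, with $0\le p\le R$ and $0\le l\le c$. For each integer $n\ge 0$, $X_n\sim Gamma(n+1,\mu)$ has density $\mu^{n+1}x^ne^{-\mu x}/n!$ on $(0,\infty)$. A lead-time quote is $d\in[0,\infty]$; $d=\infty$ means no compensation, with $(x-\infty)^+=0$. Expected utility of a joining customer who finds $n$ customers and is quoted $d$: $$B_n(d)=E\left[\frac{1-e^{-r(R-p-cX_n+l(X_n-d)^+)}}{r}\right]\in[-\infty,\infty).$$ The customer joins iff $B_n(d)\ge 0$. Let $L_n(d)=E(X_n-d)^+$, and let $G_n(d)=p-lL_n(d)$ if $B_n(d)\ge0$, $G_n(d)=0$ if $B_n(d)<0$. Put $\underline n=\inf\{n\ge0:\lim_{d\to\infty}B_n(d)<0\}$, $\overline n=\inf\{n\ge0:B_n(0)<0\}$ (with $\inf\varnothing=\infty$), $q(n;n_0)=\rho^n/\sum_{k=0}^{n_0}\rho^k$ for $0\le n\le n_0$, and $\tilde d^P_n=\sup\{d\ge0:B_n(d)\ge0\}$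 with $\sup\varnothing=-1$. For $n=0,1,\ldots,\overline n-1$, $\tilde d^S_n$ denotes the optimal lead-time that induces a customer to join in state $n$, i.e. the lead-time maximizing $G_n(d)+B_n(d)$ over $d\in[0,\tilde d^P_n]$. The supremum is over vectors $D_{n_0}=(d_0,\ldots,d_{n_0})$ of nonnegative quotes such that $B_n(d_n)\ge0$ for $n=0,\ldots,n_0-1$ and $B_{n_0}(d_{n_0})<0$ (so that the balking threshold is $n_0$). The social benefit per unit time is $S(n_0,D_{n_0})=\lambda\sum_{n=0}^{n_0-1}q(n;n_0)(G_n(d_n)+B_n(d_n))$.
   Formalization: The last quote is taken as max(0, d^P_{n0}+ε), because when no quote is accepted in state n0 one has d^P_{n0} = −1, and for ε<1 the quote d^P_{n0}+ε would be negative, hence not admissible. *)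

(* Defs.v *)
(* MathComp / MathComp-Analysis *)
From mathcomp Require Export all_boot all_order all_algebra.
From mathcomp Require Export all_classical all_reals all_analysis.

Set Implicit Arguments.
Unset Strict Implicit.
Unset Printing Implicit Defensive.

Export Order.TTheory GRing.Theory Num.Theory.
Export numFieldNormedType.Exports.

Local Open Scope classical_set_scope.
Local Open Scope ring_scope.
Local Open Scope ereal_scope.

(* Gamma distribution with integer shape [n.+1] and rate [mu]. *)
Definition gamma_pdf {R : realType} (n : nat) (mu : R) : R -> R :=
  (fun x => mu ^+ n.+1 * x ^+ n * expR (- (mu * x)) / n`!%:R)%R \_ `]0%R, +oo[.

(* Raw data only: sign and order constraints are hypotheses of the theorem. *)
Record queue (R : realType) := Queue {
  arrival_rate : R;
  service_rate : R;
  service_value : R;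
  entrance_fee : R;
  waiting_cost : R;
  compensation_rate : R;
  risk_aversion : R }.

Section quotation.
Context {R : realType} {disp : measure_display} {T : measurableType disp}
  {P : probability T R}.
Variables (M : queue R) (X : nat -> {RV P >-> R}).

Local Notation lambda := (arrival_rate M).
Local Notation mu := (service_rate M).
Local Notation V := (service_value M).
Local Notation p := (entrance_fee M).
Local Notation c := (waiting_cost M).
Local Notation l := (compensation_rate M).
Local Notation r := (risk_aversion M).

(* (x - d)^+ for a quote d in [0, +oo]; it is 0 for d = +oo.  [fine] is
   harmless, since the maximum is finite as soon as d is not -oo. *)
Definition delay (x : R) (d : \bar R) : R := fine (maxe (x%:E - d) 0).

Definition utility (n : nat) (d : \bar R) : \bar R :=
  'E_P[fun w =>
    ((1 - expR (- (r * (V - p - c * X n w + l * delay (X n w) d)))) / r)%R].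

Definition mean_delay (n : nat) (d : \bar R) : \bar R :=
  'E_P[fun w => delay (X n w) d].

Definition gain (n : nat) (d : \bar R) : \bar R :=
  if 0 <= utility n d then p%:E - l%:E * mean_delay n d else 0.

(* The infimum over natural numbers is taken in \bar R, where the infimum of
   the empty set is +oo. *)
Definition n_lower : \bar R :=
  ereal_inf [set n%:R%:E | n in
    [set n : nat | lim (utility n x%:E @[x --> +oo%R]) < 0]].

Definition n_upper : \bar R :=
  ereal_inf [set n%:R%:E | n in [set n : nat | utility n 0 < 0]].

(* The convention sup(empty) = -1 differs from that of [ereal_sup]. *)
Definition dP (n : nat) : \bar R :=
  let A := [set d : \bar R | 0 <= d /\ 0 <= utility n d] in
  if A == set0 then (-1)%:E else ereal_sup A.

(* A predicate, since the maximizer need not be unique (for l = 0 the objective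
   does not depend on the quote). *)
Definition is_dS (n : nat) (d : \bar R) : Prop :=
  [/\ 0 <= d, d <= dP n &
      forall d', 0 <= d' -> d' <= dP n ->
        gain n d' + utility n d' <= gain n d + utility n d].

Definition q (n n0 : nat) : R :=
  let rho := (lambda / mu)%R in
  (rho ^+ n / \sum_(0 <= k < n0.+1) rho ^+ k)%R.

Definition feasible (n0 : nat) (D : 'I_n0.+1 -> \bar R) : Prop :=
  [/\ forall i, 0 <= D i,
      forall i : 'I_n0.+1, (i < n0)%N -> 0 <= utility i (D i) &
      utility n0 (D ord_max) < 0].

Definition social_benefit (n0 : nat) (D : 'I_n0.+1 -> \bar R) : \bar R :=
  lambda%:E * \sum_(i < n0.+1 | (i < n0)%N)
    (q i n0)%:E * (gain i (D i) + utility i (D i)).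

Definition Z (n0 : nat) : \bar R :=
  ereal_sup [set social_benefit D | D in @feasible n0].

Definition optimal (n0 : nat) (D : 'I_n0.+1 -> \bar R) : Prop :=
  feasible D /\ social_benefit D = Z n0.

(* Quote dS n in the states n < n0, and dP n0 + eps in state n0.  The maximum
   with 0 only matters when dP n0 = -1 (every quote makes the customer balk) and
   eps < 1, where dP n0 + eps would be negative, hence not a quote. *)
Definition quotation (n0 : nat) (dS : nat -> \bar R) (eps : R) :
    'I_n0.+1 -> \bar R :=
  fun i => if (i < n0)%N then dS i else maxe 0 (dP n0 + eps%:E).

End quotation.

Arguments quotation {R disp T P} M X n0 dS eps _.

(* Main.v *)
Require Import Defs.
From mathcomp Require Import measurable_realfun lra ring.

(** Throughout, [M] is the queue, [n] the number of customers found on arrival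
    and [d] the quote. Since the social benefit is a sum over the states
    below [n0], with nonnegative weights that do not depend on the quotes, it
    can be maximized state by state. In a state [n < n0] the customer has to
    join, which happens exactly when the quote is at most [dP n]
    ([utility_ge0_dP]); so the constraint on the quote is the interval
    [[0, dP n]], over which [dS n] is optimal by definition. In the state [n0]
    the customer has to balk, which by the same equivalence every quote above
    [dP n0] achieves; such quotes exist because [dP n0] is finite ([dP_lty]).

    All of this rests on writing the utility as [1/r] minus an expected [loss],
    the exponential of a random variable, which is nonnegative and thus has an
    expectation in [[0, +oo]] whatever the parameters are. In a fixed state
    this [disutility] increases with the quote, at most at an exponential
    rate, since the compensation is a Lipschitz function of the quote
    ([disutility_exp_lip]). Hence it is finite for every finite quote as soon
    as it is finite for one, and continuous in that case. Continuity at the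
    infinite quote comes from monotone convergence ([disutility_cvg]). These
    two facts make the set of quotes that are accepted closed, so that [dP n]
    itself is accepted ([utility_sup_ge0]), and they make the objective that
    [dS n] maximizes continuous enough to attain its maximum on [[0, dP n]],
    even when this interval contains [+oo] ([is_dS_exists]).

    That [dP n0] is finite for [n0 >= n_lower] uses the comparison of
    different states: because [l <= c], the loss increases with the
    waiting time, and Gamma variables increase stochastically with their shape
    ([gamma_stochastic_le]), so that the utility decreases with the state. If
    every quote were accepted in the state [n0], then every quote would be
    accepted in all states up to [n0], the limits that define [n_lower] would
    be nonnegative in these states, and [n_lower] would exceed [n0]. *)

Local Open Scope classical_set_scope.
Local Open Scope ring_scope.
Local Open Scope ereal_scope.

(** * Integration against densities *)

Section density.
Context d1 d2 (T1 : measurableType d1) (T2 : measurableType d2) (R : realType).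
Import HBNNSimple.

(** The map [phi] lets the two measures live on different measurable
    structures over the same set, as do the Lebesgue measure and the
    distribution of a real random variable. *)
Lemma ge0_integral_density (mu : {measure set T1 -> \bar R})
    (nu : {measure set T2 -> \bar R}) (phi : T1 -> T2) (g : T1 -> R)
    (f : T2 -> \bar R) :
  measurable_fun setT phi -> measurable_fun setT g -> (forall x, 0 <= g x)%R ->
  (forall A, measurable A -> nu A = \int[mu]_(x in phi @^-1` A) (g x)%:E) ->
  measurable_fun setT f -> (forall y, 0 <= f y) ->
  \int[nu]_y f y = \int[mu]_x (f (phi x) * (g x)%:E).
Proof.
move=> mphi mg g0 nug mf f0.
have mEg : measurable_fun setT (EFin \o g) by exact/measurable_EFinP.
have eg0 x : 0 <= (g x)%:E by rewrite lee_fin.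
have gind A : measurable A ->
    \int[mu]_x ((\1_A (phi x))%:E * (g x)%:E) = nu A.
  move=> mA; rewrite nug// [RHS]integral_mkcond; apply: eq_integral => x _.
  rewrite patchE indicE.
  rewrite (_ : (x \in phi @^-1` A) = (phi x \in A)); last first.
    by apply/idP/idP => /set_mem /= ?; exact/mem_set.
  by case: ifPn => _; rewrite ?mul1e ?mul0e.
pose h := nnsfun_approx measurableT mf.
have hf y : (h n y)%:E @[n --> \oo] --> f y by exact: cvg_nnsfun_approx.
have mh n : measurable_fun setT (fun x => (h n (phi x))%:E).
  by apply/measurable_EFinP; exact: measurableT_comp.
have -> : \int[nu]_y f y = limn (fun n => \int[nu]_y (h n y)%:E).
  rewrite -monotone_convergence//.
  - by apply: eq_integral => x _; exact/esym/cvg_lim.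
  - by move=> n; exact/measurable_EFinP.
  - by move=> n x _; rewrite lee_fin.
  - by move=> x _ a b ab; rewrite lee_fin; exact/lefP/nd_nnsfun_approx.
have -> : \int[mu]_x (f (phi x) * (g x)%:E) =
    limn (fun n => \int[mu]_x ((h n (phi x))%:E * (g x)%:E)).
  rewrite -monotone_convergence//.
  - by apply: eq_integral => x _; apply/esym/cvg_lim => //; exact: cvgeZr.
  - by move=> n; exact: emeasurable_funM.
  - by move=> n x _; rewrite mule_ge0 ?lee_fin.
  - move=> x _ a b ab; rewrite lee_wpmul2r// lee_fin.
    exact/lefP/nd_nnsfun_approx.
congr (limn _); apply/funext => n.
rewrite integralT_nnsfun sintegralE.
have mind y : measurable_fun setT
    (fun x => (\1_(h n @^-1` [set y]) (phi x))%:E : \bar R).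
  by apply/measurable_EFinP; exact: measurableT_comp.
under eq_integral => x _.
  rewrite fimfunE -fsumEFin// ge0_mule_fsuml; last first.
    by move=> y; rewrite EFinM; exact: nnfun_muleindic_ge0.
  over.
rewrite ge0_integral_fsum//; last 2 first.
- move=> y; apply: emeasurable_funM => //.
  by under eq_fun do rewrite EFinM; exact: emeasurable_funM.
- by move=> y x _; rewrite mule_ge0// EFinM nnfun_muleindic_ge0.
apply: eq_fsbigr => y /[!inE] -[x _ <-].
under eq_integral do rewrite EFinM -muleA.
rewrite ge0_integralZl ?lee_fin//.
- by rewrite gind.
- exact: emeasurable_funM.
- by move=> z _; rewrite mule_ge0// lee_fin.
Qed.

End density.

Section expectation.
Context d (T : measurableType d) (R : realType).

(** The expectation of [Z] may be infinite here. Then the left-hand side is the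
    integral of a function that is not integrable but whose positive part,
    bounded by [a], is; so it is -oo, as is the right-hand side. *)
Lemma expectation_cstB (P : probability T R) (a : R) (Z : T -> R) :
  (0 <= a)%R -> measurable_fun setT Z -> (forall w, 0 <= Z w)%R ->
  'E_P[fun w => (a - Z w)%R] = a%:E - \int[P]_w (Z w)%:E.
Proof.
move=> a0 mZ Z0; rewrite unlock integralE.
set f := fun w => (a - Z w)%:E.
have mf : measurable_fun setT f.
  by apply/measurable_EFinP; exact: measurable_funB.
have mfp : measurable_fun setT f^\+ by exact: measurable_funepos.
have mfn : measurable_fun setT f^\- by exact: measurable_funeneg.
have mEZ : measurable_fun setT (EFin \o Z) by exact/measurable_EFinP.
have fpos0 w : 0 <= f^\+ w by exact: funepos_ge0.
have fneg0 w : 0 <= f^\- w by exact: funeneg_ge0.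
(* With f = a - Z, this integrates the identity f^+ + Z = a + f^-, in which
   all terms are nonnegative. *)
have key : \int[P]_w f^\+ w + \int[P]_w (Z w)%:E = a%:E + \int[P]_w f^\- w.
  rewrite -(@ge0_integralD _ _ _ P _ measurableT f^\+ (EFin \o Z))//; last first.
    by move=> w _; rewrite lee_fin.
  have -> : a%:E = \int[P]_w (cst a%:E) w.
    by rewrite integral_cst//= probability_setT mule1.
  rewrite -ge0_integralD//.
  apply: eq_integral => w _ /=; rewrite funeposE funenegE /f/=.
  rewrite -!EFin_max -!EFinD; congr EFin; rewrite !maxEle.
  by do 2 case: ifPn => ?; lra.
have pfin : \int[P]_w f^\+ w \is a fin_num.
  rewrite ge0_fin_numE; last exact: integral_ge0.
  apply: (@le_lt_trans _ _ (\int[P]_w (cst a%:E) w)).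
    apply: ge0_le_integral => //= w _; rewrite funeposE /f/= -EFin_max lee_fin.
    by rewrite ge_max a0 andbT; have := Z0 w; lra.
  by rewrite integral_cst//= probability_setT mule1 ltry.
have B0 : 0 <= \int[P]_w (Z w)%:E.
  by apply: integral_ge0 => w _; rewrite lee_fin.
have C0 : 0 <= \int[P]_w f^\- w by exact: integral_ge0.
have trade (A B C : \bar R) : A \is a fin_num -> 0 <= B -> 0 <= C ->
    A + B = a%:E + C -> A - C = a%:E - B.
  by case: A B C => [A||] [B||] [C||]//= _ _ _ [h]; congr EFin; lra.
exact: trade pfin B0 C0 key.
Qed.

End expectation.

(** * Gamma variables *)

Section gamma_density.
Context {R : realType}.
Variable mu : R.
Hypothesis mu_gt0 : (0 < mu)%R.

Lemma gamma_pdf_ge0 n x : (0 <= gamma_pdf n mu x)%R.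
Proof.
rewrite /gamma_pdf patchE; case: ifPn => //; rewrite inE/= in_itv/= andbT => x0.
by rewrite !mulr_ge0 ?invr_ge0 ?exprn_ge0 ?expR_ge0// ltW.
Qed.

Lemma measurable_gamma_pdf n : measurable_fun setT (gamma_pdf n mu).
Proof.
apply/(measurable_restrictT _ _).1 => //; apply: measurable_funTS.
apply: measurable_funM => //; apply: measurable_funM.
  by apply: measurable_funM => //; exact: exprn_measurable.
by apply: measurableT_comp => //; apply: measurableT_comp.
Qed.

(** The recurrence from which both the finite mean and the comparison of two
    consecutive densities are drawn. *)
Lemma gamma_pdfS n x :
  (x * gamma_pdf n mu x = n.+1%:R / mu * gamma_pdf n.+1 mu x)%R.
Proof.
rewrite /gamma_pdf !patchE; case: ifPn => [_|_]; last by rewrite !mulr0.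
rewrite factS natrM !exprS; field.
by rewrite nat1r !pnatr_eq0 -lt0n fact_gt0 (gt_eqF mu_gt0).
Qed.

End gamma_density.

Section gamma_variables.
Context {R : realType} {disp : measure_display} {T : measurableType disp}
  {P : probability T R} (mu : R) (X : nat -> {RV P >-> R}).
Hypothesis mu_gt0 : (0 < mu)%R.
Hypothesis X_gamma : forall (n : nat) (A : set R), measurable A ->
  distribution P (X n) A = \int[lebesgue_measure]_(x in A) (gamma_pdf n mu x)%:E.

Lemma ge0_integral_gamma n (h : R -> R) :
  measurable_fun setT h -> (forall x, 0 <= h x)%R ->
  \int[P]_w (h (X n w))%:E =
  \int[lebesgue_measure]_x ((h x)%:E * (gamma_pdf n mu x)%:E).
Proof.
move=> mh h0; have mEh : measurable_fun setT (EFin \o h).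
  exact/measurable_EFinP.
rewrite -(@ge0_integral_density _ _ (measurableTypeR R) R R
    (@lebesgue_measure R) (distribution P (X n)) id _ (EFin \o h))//.
- by rewrite ge0_integral_distribution// => x; rewrite lee_fin.
- exact: measurable_gamma_pdf.
- by move=> x; exact: gamma_pdf_ge0.
- exact: X_gamma.
Qed.

Lemma integral_gamma_pdf n : \int[lebesgue_measure]_x (gamma_pdf n mu x)%:E = 1.
Proof. by rewrite -X_gamma// probability_setT. Qed.

(** By [gamma_pdfS], the integral is a multiple of the total mass of the next
    Gamma density, which is 1 because this is the density of [X n.+1]. *)
Lemma gamma_pos_part_mean_lty n : \int[P]_w (Num.max (X n w) 0)%:E < +oo.
Proof.
rewrite (ge0_integral_gamma n (fun x => Num.max x 0%R)); last 2 first.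
- exact: measurable_maxr.
- by move=> x; rewrite le_max lexx orbT.
have S0 : (0 <= n.+1%:R / mu :> R)%R by rewrite divr_ge0// ltW.
under eq_integral => x _.
  have -> : (Num.max x 0)%:E * (gamma_pdf n mu x)%:E =
      (n.+1%:R / mu)%:E * (gamma_pdf n.+1 mu x)%:E.
    rewrite -!EFinM -gamma_pdfS//; congr EFin.
    case: (lerP 0 x) => // x0; rewrite mul0r /gamma_pdf patchE ifN ?mulr0//.
    by apply/negP => /set_mem/=; rewrite in_itv/= (lt_gtF x0).
  over.
rewrite ge0_integralZl//.
- by rewrite integral_gamma_pdf mule1 ltry.
- by apply/measurable_EFinP; exact: measurable_gamma_pdf.
- by move=> x _; rewrite lee_fin gamma_pdf_ge0.
Qed.

(** The two densities cross once: by [gamma_pdfS] their ratio is [x / t] with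
    [t = n.+1 / mu]. So [h x - h t] and the difference of the densities at [x]
    have the same sign, and their product integrates to a nonnegative
    number. Both densities have mass 1, so the constant [h t] contributes
    nothing. *)
Lemma gamma_stochastic_le n (h : R -> R) :
  measurable_fun setT h -> (forall x, 0 <= h x)%R ->
  {homo h : x y / (x <= y)%R} ->
  \int[P]_w (h (X n w))%:E <= \int[P]_w (h (X n.+1 w))%:E.
Proof.
move=> mh h0 nd_h; rewrite !ge0_integral_gamma//.
set t := (n.+1%:R / mu)%R.
have t_gt0 : (0 < t)%R by rewrite divr_gt0.
have mg k : measurable_fun [set: measurableTypeR R] (fun x => (gamma_pdf k mu x)%:E).
  by apply/measurable_EFinP; exact: measurable_gamma_pdf.
have g0 k x : 0 <= (gamma_pdf k mu x)%:E by rewrite lee_fin gamma_pdf_ge0.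
have mEh : measurable_fun [set: measurableTypeR R] (EFin \o h).
  exact/measurable_EFinP.
have mhg k : measurable_fun [set: measurableTypeR R]
    (fun x => (h x)%:E * (gamma_pdf k mu x)%:E).
  exact: emeasurable_funM.
have hg0 k x : 0 <= (h x)%:E * (gamma_pdf k mu x)%:E.
  by rewrite mule_ge0// lee_fin.
have mtg k : measurable_fun [set: measurableTypeR R]
    (fun x => (h t)%:E * (gamma_pdf k mu x)%:E).
  exact: emeasurable_funM.
have tg0 k x : 0 <= (h t)%:E * (gamma_pdf k mu x)%:E.
  by rewrite mule_ge0// lee_fin.
have tgE k : \int[lebesgue_measure]_x ((h t)%:E * (gamma_pdf k mu x)%:E) =
    (h t)%:E.
  rewrite -[RHS]mule1 -(integral_gamma_pdf k).
  by apply: ge0_integralZl; rewrite ?lee_fin.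
(* The subtractions are moved to the other side, for the integrals of h may be
   infinite. *)
have crossing : \int[lebesgue_measure]_x
      ((h x)%:E * (gamma_pdf n mu x)%:E + (h t)%:E * (gamma_pdf n.+1 mu x)%:E)
    <= \int[lebesgue_measure]_x
      ((h x)%:E * (gamma_pdf n.+1 mu x)%:E + (h t)%:E * (gamma_pdf n mu x)%:E).
  apply: ge0_le_integral => //.
  - by move=> x _; exact: adde_ge0.
  - exact: (emeasurable_funD (mhg n) (mtg n.+1)).
  - exact: (emeasurable_funD (mhg n.+1) (mtg n)).
  - move=> x _; rewrite -!EFinM -!EFinD lee_fin.
    have gS : gamma_pdf n.+1 mu x = (x / t * gamma_pdf n mu x)%R.
      by rewrite mulrAC gamma_pdfS// -/t mulrC mulKf ?gt_eqF.
    have xt : (0 <= (h x - h t) * (x / t - 1))%R.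
      have [xt|/ltW tx] := lerP x t.
        apply: mulr_le0; first by rewrite subr_le0 nd_h.
        by rewrite subr_le0 ler_pdivrMr// mul1r.
      apply: mulr_ge0; first by rewrite subr_ge0 nd_h.
      by rewrite subr_ge0 ler_pdivlMr// mul1r.
    have := mulr_ge0 xt (gamma_pdf_ge0 _ mu_gt0 n x).
    rewrite gS; nra.
rewrite !ge0_integralD// !tgE in crossing.
by rewrite leeD2rE in crossing.
Qed.

End gamma_variables.

(** * Compensated delay and loss *)

Section delay.
Context {R : realType}.
Implicit Types (x y d e : R).

Lemma delay_fin x d : delay x d%:E = Num.max (x - d)%R 0%R.
Proof. by rewrite /delay -EFinB -EFin_max. Qed.

Lemma delay_pinfty x : delay x +oo = 0%R.
Proof. by rewrite /delay /= maxNye. Qed.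

Lemma delay_ge0 x (D : \bar R) : (0 <= delay x D)%R.
Proof. by rewrite /delay fine_ge0// le_max lexx orbT. Qed.

Lemma delay_anti x (D E : \bar R) : -oo < D -> D <= E ->
  (delay x E <= delay x D)%R.
Proof.
case: D E => [d||] [e||] // _ de; rewrite ?delay_pinfty ?delay_ge0//.
rewrite !delay_fin; move: de; rewrite lee_fin => de.
by rewrite ge_max !le_max lexx orbT andbT lerD2l lerN2 de.
Qed.

Lemma delay_sub_time x y (D : \bar R) : (x <= y)%R ->
  (delay y D - delay x D <= y - x)%R.
Proof.
move=> xy; case: D => [d||]; rewrite ?delay_pinfty ?/delay/= ?subr0 ?subr_ge0//.
rewrite -!EFinB -!EFin_max/= !maxEle; do 2 case: ifPn => ?; lra.
Qed.

Lemma delay_sub_quote x d e : (delay x d%:E - delay x e%:E <= `|d - e|)%R.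
Proof.
rewrite !delay_fin; have := ler_norm (e - d); rewrite distrC.
have := normr_ge0 (e - d)%R; rewrite distrC.
rewrite !maxEle; do 2 case: ifPn => ?; lra.
Qed.

Lemma measurable_delay (D : \bar R) : measurable_fun setT (delay ^~ D).
Proof.
case: D => [d||].
- rewrite (_ : delay ^~ _ = fun x => Num.max (x - d)%R 0%R); last first.
    by apply/funext => x; exact: delay_fin.
  by apply: measurable_maxr => //; exact: measurable_funB.
- have -> : delay ^~ +oo = cst 0%R :> (R -> R).
    by apply/funext => x; exact: delay_pinfty.
  exact: measurable_cst.
- have -> : delay ^~ -oo = cst 0%R :> (R -> R).
    by apply/funext => x.
  exact: measurable_cst.
Qed.

End delay.

Section loss.
Context {R : realType}.
Variable M : queue R.
Local Notation V := (service_value M).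
Local Notation p := (entrance_fee M).
Local Notation c := (waiting_cost M).
Local Notation l := (compensation_rate M).
Local Notation r := (risk_aversion M).
Hypothesis l_ge0 : (0 <= l)%R.
Hypothesis l_le : (l <= c)%R.
Hypothesis r_gt0 : (0 < r)%R.

(** The exponential part of the integrand of [utility]: the integrand itself is
    [r^-1 - loss d x]. *)
Definition loss (d : \bar R) (x : R) : R :=
  (expR (- (r * (V - p - c * x + l * delay x d))) / r)%R.

Lemma loss_ge0 d x : (0 <= loss d x)%R.
Proof. by rewrite /loss divr_ge0 ?expR_ge0// ltW. Qed.

(** Waiting longer costs [c] per unit of time and is compensated at a rate of
    at most [l], and [l <= c]. *)
Lemma loss_le_time d : {homo loss d : x y / (x <= y)%R}.
Proof.
move=> x y xy; rewrite /loss ler_pM2r ?invr_gt0// ler_expR lerN2 ler_pM2l//.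
have dxy := delay_sub_time _ _ d xy.
have := ler_wpM2l l_ge0 dxy.
have : (l * (y - x) <= c * (y - x))%R by rewrite ler_wpM2r// subr_ge0.
lra.
Qed.

Lemma loss_le_quote d e x : -oo < d -> d <= e -> (loss d x <= loss e x)%R.
Proof.
move=> dy de; rewrite /loss ler_pM2r ?invr_gt0// ler_expR lerN2 ler_pM2l//.
by rewrite lerD2l ler_wpM2l// delay_anti.
Qed.

(** Changing the quote by [`|d - e|] changes the delay by at most as much, hence
    the exponent of the loss by at most [r * l * `|d - e|]. *)
Lemma loss_exp_lip (d e x : R) :
  (loss e%:E x <= expR (r * l * `|d - e|) * loss d%:E x)%R.
Proof.
rewrite /loss mulrA -expRD ler_pM2r ?invr_gt0// ler_expR.
have rl : (0 <= r * l)%R by rewrite mulr_ge0// ltW.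
have := ler_wpM2l rl (delay_sub_quote x d e); nra.
Qed.

Lemma measurable_loss d : measurable_fun setT (loss d).
Proof.
rewrite /loss; apply: measurable_funM => //; apply: measurableT_comp => //.
apply: measurableT_comp => //; apply: measurable_funM => //.
apply: measurable_funD; last first.
  by apply: measurable_funM => //; exact: measurable_delay.
by apply: measurable_funB => //; exact: measurable_funM.
Qed.

End loss.

(** * Continuity and maxima *)

Section real_functions.
Context {R : realType}.

Lemma cvg_dist (x : R) : `|x - y|%R @[y --> x] --> 0%R.
Proof.
rewrite [X in _ --> X](_ : _ = `|x - x|%R); last by rewrite subrr normr0.
by apply: cvg_norm; apply: cvgB; [exact: cvg_cst|exact: cvg_id].
Qed.

Lemma cvg_expR_dist (k x a : R) :
  (expR (k * `|x - y|) * a)%R @[y --> x] --> a.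
Proof.
rewrite -[X in _ --> X]mul1r -expR0 -(mulr0 k).
apply: cvgM; last exact: cvg_cst.
apply: (@cvg_comp _ _ _ (fun y => k * `|x - y|)%R expR _ (nbhs (k * 0)%R)).
  by apply: cvgM; [exact: cvg_cst|exact: cvg_dist].
exact: continuous_expR.
Qed.

Lemma lip_continuous (f : R -> R) :
  (forall d e, f d <= f e + `|d - e|)%R -> continuous f.
Proof.
move=> f_lip x.
apply: (@squeeze_cvgr _ _ _ _ (fun y => f x - `|x - y|)%R
                              (fun y => f x + `|x - y|)%R).
- apply: nearW => y; have := f_lip x y; have := f_lip y x.
  by rewrite (distrC y x) => *; apply/andP; split; lra.
- rewrite -[X in _ --> X]subr0.
  by apply: cvgB; [exact: cvg_cst|exact: cvg_dist].
- rewrite -[X in _ --> X]addr0.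
  by apply: cvgD; [exact: cvg_cst|exact: cvg_dist].
Qed.

(** The bound with [d] and [e] exchanged is a lower bound for [f e], and both
    bounds tend to [f d] when [e] tends to [d]. *)
Lemma exp_lip_continuous (k : R) (f : R -> R) :
  (forall d e, f e <= expR (k * `|d - e|) * f d)%R -> continuous f.
Proof.
move=> f_lip x.
apply: (@squeeze_cvgr _ _ _ _ (fun y => expR ((- k) * `|x - y|) * f x)%R
                              (fun y => expR (k * `|x - y|) * f x)%R).
- apply: nearW => y; rewrite f_lip andbT.
  by rewrite mulNr expRN mulrC ler_pdivrMr ?expR_gt0// mulrC distrC f_lip.
- exact: cvg_expR_dist.
- exact: cvg_expR_dist.
Qed.

(** A continuous function on a bounded interval attains its maximum. On
    [[0, +oo]], the last hypothesis is upper semicontinuity at [+oo]: either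
    [G +oo] is the maximum, or some [F x0] exceeds it, and then the function
    stays below [F x0] beyond some [b], so that the search is confined to the
    bounded interval up to the maximum of [b] and [x0]. *)
Lemma ereal_argmax (G : \bar R -> \bar R) (F : R -> R) (s : \bar R) :
  continuous F -> 0 <= s ->
  (forall x : R, 0 <= x%:E -> x%:E <= s -> G x%:E = (F x)%:E) ->
  (s = +oo -> exists2 Fy : R, G +oo = Fy%:E &
     forall a, (Fy < a)%R -> exists b, forall x, (b < x)%R -> (F x < a)%R) ->
  exists d, [/\ 0 <= d, d <= s &
    forall d', 0 <= d' -> d' <= s -> G d' <= G d].
Proof.
move=> cF s_ge0 GF Goo.
have maxF (b : R) : (0 <= b)%R -> exists x : R, [/\ (0 <= x)%R, (x <= b)%R &
    forall y, (0 <= y)%R -> (y <= b)%R -> (F y <= F x)%R].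
  move=> b0.
  have cFb : {within `[0%R, b], continuous F} by exact: continuous_subspaceT.
  have [x + xmax] := EVT_max b0 cFb.
  rewrite in_itv/= => /andP[x0 xb]; exists x; split => // y y0 yb.
  by apply: xmax; rewrite in_itv/= y0.
case: s s_ge0 GF Goo => [b||]// b0 GF.
  move=> _; have [x [x0 xb xmax]] := maxF b b0.
  exists x%:E; split => // -[y||]// y0 yb.
  by rewrite !GF// lee_fin xmax.
move=> /(_ erefl)[Fy Gy Fy_lt].
have GFx (x : R) : (0 <= x)%R -> G x%:E = (F x)%:E.
  by move=> x0; rewrite GF ?leey.
have [Fy_max|/existsNP[x0 /not_implyP[x0_ge0 /negP]]] :=
    pselect (forall x, 0 <= x -> F x <= Fy)%R.
  exists +oo; split => // -[y||]// y0 _.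
  by rewrite Gy GFx// lee_fin Fy_max.
rewrite -ltNge => Fyx0; have [b Fb] := Fy_lt _ Fyx0.
have [|x [x_ge0 xb xmax]] := maxF (Num.max b x0).
  by rewrite le_max x0_ge0 orbT.
have Fx0 : (F x0 <= F x)%R by apply: xmax; rewrite // le_max lexx orbT.
exists x%:E; split; rewrite ?leey// => -[y||]// y0 _; last first.
  by rewrite Gy GFx// lee_fin; lra.
rewrite !GFx// lee_fin.
have [yb|] := lerP y (Num.max b x0); first exact: xmax.
by rewrite gt_max => /andP[/Fb ? _]; lra.
Qed.

End real_functions.

(** * Utility and acceptable quotes *)

Section utility.
Context {R : realType} {disp : measure_display} {T : measurableType disp}
  {P : probability T R}.
Variables (M : queue R) (X : nat -> {RV P >-> R}).
Local Notation p := (entrance_fee M).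
Local Notation c := (waiting_cost M).
Local Notation l := (compensation_rate M).
Local Notation r := (risk_aversion M).
Hypothesis mu_gt0 : (0 < service_rate M)%R.
Hypothesis l_ge0 : (0 <= l)%R.
Hypothesis l_le : (l <= c)%R.
Hypothesis r_gt0 : (0 < r)%R.
Hypothesis X_gamma : forall (n : nat) (A : set R), measurable A ->
    distribution P (X n) A =
    \int[lebesgue_measure]_(x in A) (gamma_pdf n (service_rate M) x)%:E.

Definition disutility n d : \bar R := \int[P]_w (loss M d (X n w))%:E.

Lemma measurable_lossX n d : measurable_fun setT (fun w => (loss M d (X n w))%:E).
Proof.
apply/measurable_EFinP; apply: (@measurableT_comp _ _ _ _ _ _ (loss M d)) => //.
exact: measurable_loss.
Qed.

Lemma disutility_ge0 n d : 0 <= disutility n d.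
Proof. by apply: integral_ge0 => w _; rewrite lee_fin loss_ge0. Qed.

Lemma utilityE n d : utility M X n d = (r^-1)%:E - disutility n d.
Proof.
rewrite /disutility -expectation_cstB ?invr_ge0 ?(ltW r_gt0)//.
- congr expectation; apply/funext => w.
  by rewrite /loss mulrBl mul1r.
- apply: (@measurableT_comp _ _ _ _ _ _ (loss M d)) => //.
  exact: measurable_loss.
- by move=> w; exact: loss_ge0.
Qed.

Lemma utility_ge0E n d : (0 <= utility M X n d) = (disutility n d <= (r^-1)%:E).
Proof. by rewrite utilityE sube_ge0 ?fin_numE ?orbT. Qed.

Lemma disutility_le_quote n d e : -oo < d -> d <= e ->
  disutility n d <= disutility n e.
Proof.
move=> dy de; apply: ge0_le_integral => //.
- by move=> w _; rewrite lee_fin loss_ge0.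
- exact: measurable_lossX.
- exact: measurable_lossX.
- by move=> w _; rewrite lee_fin loss_le_quote.
Qed.

Lemma disutility_exp_lip n (d e : R) :
  disutility n e%:E <= (expR (r * l * `|d - e|))%:E * disutility n d%:E.
Proof.
rewrite /disutility -ge0_integralZl ?lee_fin ?expR_ge0//.
- apply: ge0_le_integral => //.
  + by move=> w _; rewrite lee_fin loss_ge0.
  + exact: measurable_lossX.
  + by apply: emeasurable_funM => //; exact: measurable_lossX.
  + by move=> w _; rewrite -EFinM lee_fin loss_exp_lip.
- exact: measurable_lossX.
- by move=> w _; rewrite lee_fin loss_ge0.
Qed.

Lemma disutility_le_state d : {homo disutility^~ d : m n / (m <= n)%N >-> m <= n}.
Proof.
apply: homo_leq; first exact: lexx.
  by move=> ? ? ?; exact: le_trans.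
move=> n; apply: (gamma_stochastic_le _ _ mu_gt0 X_gamma n (loss M d)).
- exact: measurable_loss.
- by move=> x; exact: loss_ge0.
- exact: loss_le_time.
Qed.

(** In every outcome the delay vanishes once the quote exceeds the waiting time,
    and the loss then has its limit value. *)
Lemma disutility_cvg n : disutility n k%:R%:E @[k --> \oo] --> disutility n +oo.
Proof.
have lim_loss x : (loss M k%:R%:E x)%:E @[k --> \oo] --> (loss M +oo x)%:E.
  apply: cvg_near_cst; near=> k; congr EFin.
  rewrite /loss delay_pinfty delay_fin; congr (expR (- (_ * (_ + _ * _))) / _)%R.
  by apply/max_idPr; rewrite subr_le0; near: k; exact: nbhs_infty_ger.
rewrite /disutility.
under [X in _ --> X]eq_integral => w _ do rewrite -(cvg_lim _ (lim_loss (X n w)))//.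
apply: cvg_monotone_convergence => //.
- by move=> k; exact: measurable_lossX.
- by move=> k w _; rewrite lee_fin loss_ge0.
- move=> w _ a b ab; rewrite lee_fin loss_le_quote// ?ltNyr// lee_fin.
  by rewrite ler_nat.
Unshelve. all: by end_near. Qed.

Lemma mean_delayE n d : mean_delay X n d = \int[P]_w (delay (X n w) d)%:E.
Proof. by rewrite /mean_delay unlock. Qed.

Lemma mean_delay_pinfty n : mean_delay X n +oo = 0.
Proof.
rewrite mean_delayE; under eq_integral do rewrite delay_pinfty.
by rewrite integral0.
Qed.

Lemma measurable_delayX n d : measurable_fun setT (fun w => (delay (X n w) d)%:E).
Proof.
apply/measurable_EFinP; apply: (@measurableT_comp _ _ _ _ _ _ (delay^~ d)) => //.
exact: measurable_delay.
Qed.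

Lemma mean_delay_ge0 n d : 0 <= mean_delay X n d.
Proof.
by rewrite mean_delayE; apply: integral_ge0 => w _; rewrite lee_fin delay_ge0.
Qed.

Lemma mean_delay_lip n (d e : R) :
  mean_delay X n d%:E <= mean_delay X n e%:E + `|d - e|%:E.
Proof.
rewrite !mean_delayE.
have -> : `|d - e|%:E = \int[P]_w (cst `|d - e|%:E) w.
  by rewrite integral_cst//= probability_setT mule1.
rewrite -ge0_integralD//; last 3 first.
- by move=> w _; rewrite lee_fin delay_ge0.
- exact: measurable_delayX.
- by move=> w _; rewrite lee_fin.
apply: ge0_le_integral => //.
- by move=> w _; rewrite lee_fin delay_ge0.
- exact: measurable_delayX.
- by apply: emeasurable_funD => //; exact: measurable_delayX.
- move=> w _ /=; rewrite -EFinD lee_fin.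
  by have := delay_sub_quote (X n w) d e; lra.
Qed.

Lemma mean_delay_fin_num n (d : R) : mean_delay X n d%:E \is a fin_num.
Proof.
rewrite ge0_fin_numE ?mean_delay_ge0//.
apply: le_lt_trans (mean_delay_lip n d 0%R) _; apply: lte_add_pinfty; last first.
  exact: ltry.
rewrite mean_delayE.
under eq_integral do rewrite delay_fin subr0.
exact: (gamma_pos_part_mean_lty _ _ mu_gt0 X_gamma).
Qed.

Lemma utility_le_quote n d e : -oo < d -> d <= e ->
  utility M X n e <= utility M X n d.
Proof.
by move=> dy de; rewrite !utilityE leeB// disutility_le_quote.
Qed.

Lemma utility_le_state d m n : (m <= n)%N ->
  utility M X n d <= utility M X m d.
Proof.
rewrite !utilityE => mn; apply: (leeB (lexx _)).
exact: (disutility_le_state d).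
Qed.

(** The supremum of acceptable quotes is acceptable. Quotes below the supremum
    have a disutility of at most [1/r]. If the supremum is a real [s], its own
    disutility exceeds that of a quote [e < s] at most by the factor
    [expR (r * l * (s - e))], which tends to 1; if it is [+oo], its disutility
    is the limit of those of the integer quotes. *)
Lemma utility_sup_ge0 n (A : set (\bar R)) :
  (forall d, A d -> 0 <= d /\ 0 <= utility M X n d) -> A !=set0 ->
  0 <= utility M X n (ereal_sup A).
Proof.
move=> A_join [d0 Ad0].
have below e : e%:E < ereal_sup A -> disutility n e%:E <= (r^-1)%:E.
  move=> /ereal_sup_gt[d /A_join[_]]; rewrite utility_ge0E => ud ed.
  apply: (le_trans _ ud); apply: disutility_le_quote => //; first exact: ltNyr.
  exact: ltW.
have sup_ge : 0 <= ereal_sup A.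
  by apply: (@le_trans _ _ d0); [have [] := A_join _ Ad0|exact: ereal_sup_ubound].
rewrite utility_ge0E; move: sup_ge below.
case: (ereal_sup A) => [s||]// _ below.
- have lip e : (e < s)%R -> disutility n s%:E <=
      (expR (r * l * `|s - e|) * r^-1)%:E.
    move=> es; apply: le_trans (disutility_exp_lip n e s) _.
    rewrite EFinM distrC; apply: lee_wpmul2l; first by rewrite lee_fin expR_ge0.
    by apply: below; rewrite lte_fin.
  have fin_s : disutility n s%:E \is a fin_num.
    rewrite ge0_fin_numE ?disutility_ge0//.
    by apply: le_lt_trans (lip (s - 1)%R _) (ltry _); lra.
  rewrite -(fineK fin_s) lee_fin.
  have cvgK : (expR (r * l * `|s - e|) * r^-1)%R @[e --> s^'-] --> (r^-1)%R.
    by apply: cvg_at_left_filter; exact: cvg_expR_dist.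
  rewrite -(cvg_lim _ cvgK)//; apply: limr_ge; first exact: cvgP cvgK.
  near=> e; rewrite -lee_fin fineK//; apply: lip.
  by near: e; exact: nbhs_left_lt.
- have cvgy := disutility_cvg n.
  rewrite -(cvg_lim _ cvgy)//; apply: lime_le; first exact: cvgP cvgy.
  by apply: nearW => k; apply: below; rewrite ltry.
Unshelve. all: by end_near. Qed.

(** The accepted quotes are closed downwards by monotonicity, and contain their
    supremum by [utility_sup_ge0]. If there are none, then [dP n = -1] lies
    below all quotes. *)
Lemma utility_ge0_dP n d : 0 <= d -> (0 <= utility M X n d) = (d <= dP M X n).
Proof.
move=> d0; rewrite /dP; set A := [set d | _].
case: ifPn => [/eqP A0|/set0P A0].
  have -> : (d <= (-1)%:E) = false.
    apply: lt_geF; apply: (lt_le_trans _ d0); rewrite lte_fin; lra.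
  by apply/negP => ud; have : A d by []; rewrite A0.
apply/idP/idP => [ud|dA]; first exact: ereal_sup_ubound.
apply: le_trans (utility_sup_ge0 n A _ A0) _ => //.
by apply: utility_le_quote => //; exact: (lt_le_trans _ d0).
Qed.

Lemma lim_utility_ge0 n : (forall x : R, 0 <= utility M X n x%:E) ->
  0 <= lim (utility M X n x%:E @[x --> +oo%R]).
Proof.
move=> u0.
have /cvg_lim -> // : utility M X n x%:E @[x --> +oo%R] -->
    ereal_inf (range (fun x : R => utility M X n x%:E)).
  apply: nonincreasing_cvge => x y xy.
  by apply: utility_le_quote; rewrite ?ltNyr ?lee_fin.
by apply: le_ereal_inf_tmp => _ [x _ <-].
Qed.

(** Otherwise all quotes are acceptable in the state [n], hence in all states
    [m <= n], where the limit of the utility is then nonnegative; so every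
    state that counts for [n_lower] is at least [n.+1]. *)
Lemma dP_lty n : n_lower M X <= n%:R%:E -> dP M X n < +oo.
Proof.
rewrite ltey; apply: contraTneq => dPy; rewrite -ltNge.
apply: (@lt_le_trans _ _ n.+1%:R%:E); first by rewrite lte_fin ltr_nat.
apply: le_ereal_inf_tmp => _ [m /= lim_lt0 <-]; rewrite lee_fin ler_nat ltnNge.
apply: contraTN lim_lt0 => mn; rewrite -leNgt; apply: lim_utility_ge0 => x.
apply: (le_trans _ (utility_le_state x%:E _ _ mn)).
(* The limit concerns all real x, but only nonnegative ones are quotes. *)
apply: (@le_trans _ _ (utility M X n (Num.max x 0)%:E)).
  by rewrite utility_ge0_dP ?dPy ?leey// lee_fin le_max lexx orbT.
by apply: utility_le_quote; rewrite ?ltNyr// lee_fin le_max lexx.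
Qed.

Lemma utility_zero_quote n : n%:R%:E < n_upper M X -> 0 <= utility M X n 0.
Proof.
rewrite leNgt; apply: contraTN => u0; rewrite -leNgt.
by apply: ereal_inf_lbound; exists n.
Qed.

(** On [[0, dP n]] the objective is [p - l * mean_delay + 1/r - disutility],
    which is continuous at finite quotes. At [+oo] it is upper
    semicontinuous, because [mean_delay] is nonnegative and vanishes there,
    while the disutility is continuous by [disutility_cvg]. *)
Lemma is_dS_exists n : 0 <= utility M X n 0 -> exists d, is_dS M X n d.
Proof.
move=> u0.
have dis0 : disutility n 0 \is a fin_num.
  rewrite ge0_fin_numE ?disutility_ge0//.
  by apply: le_lt_trans (ltry r^-1); rewrite -utility_ge0E.
have disE (d : R) : disutility n d%:E \is a fin_num.
  rewrite ge0_fin_numE ?disutility_ge0//.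
  apply: le_lt_trans (disutility_exp_lip n 0%R d) _.
  by rewrite -(fineK dis0) -EFinM ltry.
have delE (d : R) := mean_delay_fin_num n d.
pose U d := fine (disutility n d%:E).
pose L d := fine (mean_delay X n d%:E).
pose F d := (p - l * L d + (r^-1 - U d))%R.
have cU : continuous U.
  apply: (@exp_lip_continuous _ (r * l)) => d e.
  have := disutility_exp_lip n d e.
  by rewrite -(fineK (disE d)) -(fineK (disE e)) -EFinM lee_fin.
have cL : continuous L.
  apply: lip_continuous => d e.
  have := mean_delay_lip n d e.
  by rewrite -(fineK (delE d)) -(fineK (delE e)) -EFinD lee_fin.
have cF : continuous F.
  move=> x; exact: (cvgD (cvgB (cvg_cst p) (cvgM (cvg_cst l) (cL x)))
                         (cvgB (cvg_cst r^-1%R) (cU x))).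
have FE (d : R) : (0 <= d)%R -> d%:E <= dP M X n ->
    gain M X n d%:E + utility M X n d%:E = (F d)%:E.
  move=> d0 ddP; rewrite /gain utility_ge0_dP ?lee_fin// ddP utilityE.
  by rewrite -(fineK (disE d)) -(fineK (delE d)).
apply: (ereal_argmax _ F) => //; first by rewrite -utility_ge0_dP.
move=> dPy.
have disy : disutility n +oo \is a fin_num.
  rewrite ge0_fin_numE ?disutility_ge0//.
  apply: le_lt_trans (ltry r^-1).
  by rewrite -utility_ge0E utility_ge0_dP// dPy.
exists (p + (r^-1 - fine (disutility n +oo)))%R.
  rewrite /gain utility_ge0_dP// dPy lexx mean_delay_pinfty mule0 sube0.
  by rewrite utilityE -{1}(fineK disy).
move=> a a_gt.
have Ucvg : U k%:R @[k --> \oo] --> fine (disutility n +oo).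
  apply/fine_cvg; rewrite fineK//.
  exact: disutility_cvg.
have [k _ Uk] : \forall k \near \oo, (p + r^-1 - a < U k%:R)%R.
  by apply: (cvgr_gt _ Ucvg); lra.
exists k%:R => y ky.
have Uky : (U k%:R <= U y)%R.
  apply: (fine_le (disE _) (disE _)).
  apply: (disutility_le_quote n); first exact: ltNyr.
  by rewrite lee_fin ltW.
have lL : (0 <= l * L y)%R by rewrite mulr_ge0// fine_ge0// mean_delay_ge0.
have Uka : (p + r^-1 - a < U k%:R)%R := Uk k (leqnn k).
rewrite /F; move: (U y) (U k%:R) (l * L y)%R Uky Uka lL => ? ? ?; lra.
Qed.

End utility.

(** * Optimal quotation *)

Lemma q_ge0 (R : realType) (M : queue R) n n0 :
  (0 < arrival_rate M)%R -> (0 < service_rate M)%R -> (0 <= q M n n0)%R.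
Proof.
move=> la mu; have rho0 : (0 <= arrival_rate M / service_rate M)%R.
  by rewrite divr_ge0 ?ltW.
by rewrite /q divr_ge0 ?exprn_ge0// sumr_ge0// => k _; exact: exprn_ge0.
Qed.

Theorem proposition6 (R : realType) (disp : measure_display)
  (T : measurableType disp) (P : probability T R)
  (M : queue R) (X : nat -> {RV P >-> R})
  (lambda_gt0 : (0 < arrival_rate M)%R)
  (mu_gt0 : (0 < service_rate M)%R)
  (p_ge0 : (0 <= entrance_fee M)%R)
  (p_le : (entrance_fee M <= service_value M)%R)
  (c_gt0 : (0 < waiting_cost M)%R)
  (l_ge0 : (0 <= compensation_rate M)%R)
  (l_le : (compensation_rate M <= waiting_cost M)%R)
  (r_gt0 : (0 < risk_aversion M)%R)
  (X_gamma : forall (n : nat) (A : set R), measurable A ->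
    distribution P (X n) A =
    \int[lebesgue_measure]_(x in A) (gamma_pdf n (service_rate M) x)%:E) :
  (forall n : nat, n%:R%:E < n_upper M X -> exists d, is_dS M X n d) /\
  (forall n0 : nat, n_lower M X <= n0%:R%:E -> n0%:R%:E <= n_upper M X ->
   forall dS : nat -> \bar R, (forall n, (n < n0)%N -> is_dS M X n (dS n)) ->
   forall eps : R, (0 < eps)%R ->
   optimal M X (quotation M X n0 dS eps)).
Proof.
have joinE := utility_ge0_dP M X l_ge0 r_gt0.
split=> [n n_lt|n0 n0_ge _ dS dS_max eps eps_gt0].
  apply: (is_dS_exists M X mu_gt0 l_ge0 r_gt0 X_gamma).
  exact: utility_zero_quote.
have feas : feasible M X (quotation M X n0 dS eps).
  split=> [i|i i_lt|].
  - rewrite /quotation; case: ifPn => [i_lt|_]; last by rewrite le_max lexx.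
    by have [] := dS_max _ i_lt.
  - rewrite /quotation i_lt; have [dS0 dSP _] := dS_max _ i_lt.
    by rewrite joinE.
  - rewrite /quotation /= ltnn ltNge joinE ?le_max ?lexx// -ltNge.
    have := dP_lty M X mu_gt0 l_ge0 l_le r_gt0 X_gamma n0 n0_ge.
    case: (dP M X n0) => [s||]// _; rewrite lt_max ?ltNyr ?ltNy0//.
    by rewrite -EFinD [X in _ || X]lte_fin ltrDl eps_gt0 orbT.
split=> //; apply/eqP; rewrite eq_le; apply/andP; split.
  by apply: ereal_sup_ubound; exists (quotation M X n0 dS eps).
apply: ge_ereal_sup => _ [D [D0 D_join _] <-].
apply: lee_wpmul2l; first by rewrite lee_fin ltW.
apply: lee_sum => i i_lt.
apply: lee_wpmul2l; first by rewrite lee_fin q_ge0.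
have [_ _ dSP] := dS_max _ i_lt.
by rewrite /quotation i_lt; apply: dSP => //; rewrite -joinE ?D_join.
Qed.
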